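(* Let $T$ be a triangulation of a closed oriented surface. For each vertex $v$ in $T$, choose a different point $P_v$ on the real/complex plane. For each edge $e$ in $T$ with endpoints $u,v$, choose a point $P_e$ on the line $(P_uP_v)$. Assume that all these points are distinct. For each triangle in $T$ with sides $a,b,c$, consider the condition $$\text{the points } P_a,\ P_b,\ \text{and } P_c \text{ are collinear.}$$ If this condition holds for all triangles in $T$ except one, then it holds for the remaining triangle.
   Context: The real/complex plane is the projective plane over the real or complex numbers. $(XY)$ denotes the line through two distinct points $X,Y$. ''All these points'' refers to all the points $P_v$ (for the vertices $v$ of $T$) and $P_e$ (for the edges $e$ of $T$). A triangulation of a closed oriented surface is here a finite cell decomposition whose 2-cells are triangles; different edges are allowed to have the same pair of endpoints.
   Formalization: It is additionally assumed that, for every triangle of T other than the remaining one, the points P_v at its three vertices are not collinear; without this the claim fails (e.g. on the boundary of a tetrahedron with one triangle whose vertices are collinear). *)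

(* Defs.v *)
From HB Require Import structures.
From mathcomp Require Import all_boot all_order all_algebra all_fingroup.

Set Implicit Arguments.
Unset Strict Implicit.
Unset Printing Implicit Defensive.

Import GRing.Theory.

Section Orbit.
Variables (D : finType) (s : {perm D}).

Definition orbit_of : Type := {c : {set D} | c \in porbits s}.

Lemma porbit_in x : porbit s x \in porbits s.
Proof. exact: imset_f. Qed.

Definition to_orbit (x : D) : orbit_of := exist _ (porbit s x) (porbit_in x).

Lemma to_orbitP x y : to_orbit x = to_orbit y <-> x \in porbit s y.
Proof.
split=> [[e]|]; first by rewrite -eq_porbit_mem e.
by rewrite -eq_porbit_mem => /eqP e; apply: val_inj.
Qed.
End Orbit.

(* A finite cell decomposition of a closed oriented surface into triangles, as
   a combinatorial map.  A dart is an edge equipped with a direction; since the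
   surface is closed and oriented, each dart runs counterclockwise along exactly
   one side of exactly one triangle.  [rev x] is the same edge in the opposite
   direction, and [next x] is the dart following [x] counterclockwise around its
   triangle.  Several edges may share the same pair of endpoints. *)
Record triangulation := Triangulation {
  dart : finType;
  rev : {perm dart};
  next : {perm dart};
  revK : forall x, rev (rev x) = x;
  rev_neq : forall x, rev x != x;
  card_next : forall x, #|porbit next x| = 3
}.

Section Cells.
Variable T : triangulation.

(* [rev * next] maps [x] to [next (rev x)]: it turns [x] about its starting
   point, to the next dart starting there. *)
Definition vertex : Type := orbit_of (rev T * next T)%g.
Definition edge : Type := orbit_of (rev T).
Definition triangle : Type := orbit_of (next T).

Definition source (x : dart T) : vertex := to_orbit (rev T * next T)%g x.
Definition target (x : dart T) : vertex := source (rev T x).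
Definition edge_of (x : dart T) : edge := to_orbit (rev T) x.
Definition triangle_of (x : dart T) : triangle := to_orbit (next T) x.

Lemma source_next (x : dart T) : source (next T x) = target x.
Proof.
apply/to_orbitP; rewrite -[next T x](_ : (rev T * next T)%g (rev T x) = _).
  by rewrite (mem_porbit _ 1).
by rewrite permM revK.
Qed.

Lemma edge_of_rev (x : dart T) : edge_of (rev T x) = edge_of x.
Proof. by apply/to_orbitP; rewrite (mem_porbit _ 1). Qed.

Definition loopless : Prop := forall x : dart T, source x <> target x.
End Cells.

Section ProjectivePlane.
Variable K : fieldType.

Definition point : Type := {U : {vspace 'rV[K]_3} | \dim U == 1}.
Definition line : Type := {U : {vspace 'rV[K]_3} | \dim U == 2}.

Definition incident (P : point) (L : line) : Prop := (val P <= val L)%VS.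

Definition collinear (P Q R : point) : Prop :=
  exists L : line, [/\ incident P L, incident Q L & incident R L].

(* [P + Q] is the line (PQ) when [P] and [Q] are distinct; see [dim_join]. *)
Definition on_line_through (P Q X : point) : Prop :=
  (val X <= val P + val Q)%VS.

Lemma dim_join (P Q : point) : P <> Q -> \dim (val P + val Q) = 2.
Proof.
case: P Q => [P dP] [Q dQ] /= neq.
have: \dim (P :&: Q) = 0.
  apply/eqP; move: (dimvS (capvSl P Q)); rewrite (eqP dP).
  case d: (\dim _) => [|[|//]] // _; case: neq; apply: val_inj => /=.
  have/eqP <-: (P :&: Q == P)%VS by rewrite eqEdim capvSl d (eqP dP).
  by apply/eqP; rewrite eqEdim capvSr d (eqP dQ).
by move=> d0; have := dimv_sum_cap P Q; rewrite d0 addn0 (eqP dP) (eqP dQ).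
Qed.
End ProjectivePlane.

Section Conditions.
Variables (T : triangulation) (K : fieldType).

Definition sides_collinear (Pe : edge T -> point K) (t : triangle T) : Prop :=
  forall x : dart T, triangle_of x = t ->
    collinear (Pe (edge_of x)) (Pe (edge_of (next T x)))
              (Pe (edge_of (next T (next T x)))).

(* If the three vertices of a triangle lie on one line, so do the points on its
   sides, and [sides_collinear] says nothing about them.  With such triangles
   the incidence theorem fails: on the boundary of a tetrahedron, take
     P1 = (0,0), P2 = (1,0), P3 = (3,0), P4 = (0,1),
     P12 = (4/3,0), P13 = (4,0), P23 = (10,0),
     P14 = (0,2), P24 = (2,-1), P34 = (6,-1);
   then the condition holds for 123, 124 and 134 but not for 234. *)
Definition vertices_not_collinear (Pv : vertex T -> point K)
    (t : triangle T) : Prop :=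
  forall x : dart T, triangle_of x = t ->
    ~ collinear (Pv (source x)) (Pv (source (next T x)))
              (Pv (source (next T (next T x)))).
End Conditions.

(* Main.v *)
From mathcomp Require Import all_boot all_order all_algebra all_fingroup.
From mathcomp Require Import reals complex ring.
Require Import Defs.

Set Implicit Arguments.
Unset Strict Implicit.
Unset Printing Implicit Defensive.

Import GRing.Theory.

(** The theorem holds because the condition on a triangle is multiplicative, and
    the factors cancel over a closed oriented surface.

    Choose one generating vector for each point [Pv v]. If [p] and [q] are those
    of [Pv u] and [Pv v], then a point on the line joining [Pv u] and [Pv v],
    other than these two, is generated by [p - m *: q] for exactly one nonzero scalar [m], its ratio
    ([on_line_ratio]). Thus each dart [x] has a ratio [m x], that of the point on
    its edge, and the opposite dart has the inverse ratio ([ratio_rev]).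

    By the theorem of Menelaus, the three points on the sides of a triangle are
    collinear if the product of the ratios of its three darts is 1
    ([ratio_collinear]), and only if so when the vertices are not collinear
    ([collinear_ratio]). The product of the ratios of all darts is 1, since the
    two directions of each edge cancel, and it is also the product over all
    triangles of the Menelaus products. Since these are 1 for all triangles but
    one, the last is 1 as well ([prod_remaining_triangle]). *)

(** * Ratios of points on a line, and the theorem of Menelaus *)

Section Points.
Variable K : fieldType.
Local Open Scope ring_scope.
Implicit Types (P Q S X Y Z : point K) (p q s x y : 'rV[K]_3).
Implicit Types a b l m n : K.

Lemma point_pick P : val P = <[vpick (val P)]>%VS.
Proof.
apply/eqP; rewrite eq_sym eqEdim -memvE memv_pick.
by rewrite dim_vline vpick0 -dimv_eq0 (eqP (valP P)).
Qed.

Lemma point_eqS P Q : (val P <= val Q)%VS -> P = Q.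
Proof.
move=> PQ; apply/val_inj/eqP.
by rewrite eqEdim PQ (eqP (valP P)) (eqP (valP Q)).
Qed.

(** [X] has coordinates [a : b] in the frame [p, q] of the line, neither of them
    zero because [X] is not an endpoint; [m] is the ratio [- b / a]. *)
Lemma on_line_ratio P Q X p q :
    val P = <[p]>%VS -> val Q = <[q]>%VS ->
    on_line_through P Q X -> P <> X -> Q <> X ->
  exists2 m, m != 0 & val X = <[p - m *: q]>%VS.
Proof.
move=> Pp Qq XPQ neqP neqQ; have Xx := point_pick X; set x := vpick _ in Xx.
move: XPQ; rewrite /on_line_through Pp Qq Xx -memvE.
case/memv_addP=> _ /vlineP[a ->] [_ /vlineP[b ->] x_eq].
have a0 : a != 0.
  apply/eqP => a0; case: neqQ; apply/esym/point_eqS.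
  by rewrite Qq Xx -memvE x_eq a0 scale0r add0r memvZ ?memv_line.
have b0 : b != 0.
  apply/eqP => b0; case: neqP; apply/esym/point_eqS.
  by rewrite Pp Xx -memvE x_eq b0 scale0r addr0 memvZ ?memv_line.
exists (- (b / a)); first by rewrite oppr_eq0 mulf_neq0 ?invr_eq0.
have -> : p - - (b / a) *: q = a^-1 *: x.
  by rewrite x_eq scalerDr !scalerA mulVf // scale1r scaleNr opprK mulrC.
apply/eqP; rewrite eq_sym eqEdim -memvE memvZ ?memv_line //= !dim_vline.
by rewrite scaler_eq0 invr_eq0 (negPf a0).
Qed.

Lemma distinct_points_indep P Q p q a b :
    val P = <[p]>%VS -> val Q = <[q]>%VS -> P <> Q -> a *: p = b *: q ->
  a = 0 /\ b = 0.
Proof.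
have indep X Y x y c d : val X = <[x]>%VS -> val Y = <[y]>%VS -> X <> Y ->
    c *: x = d *: y -> c = 0.
  move=> Xx Yy neqXY cx_dy; apply/eqP/negPn/negP => c0; case: neqXY.
  apply: point_eqS; rewrite Xx Yy -memvE -[x](scalerK c0) cx_dy.
  by rewrite !memvZ ?memv_line.
move=> Pp Qq neqPQ ap_bq; split; first exact: indep Pp Qq neqPQ ap_bq.
exact: indep Qq Pp (nesym neqPQ) (esym ap_bq).
Qed.

(** A point has only one ratio with respect to given generators, so reading the
    same point of the line from the other end inverts its ratio. *)
Lemma ratio_rev P Q p q m n :
    val P = <[p]>%VS -> val Q = <[q]>%VS -> P <> Q ->
    <[p - m *: q]>%VS = <[q - n *: p]>%VS ->
  m * n = 1.
Proof.
move=> Pp Qq neqPQ eqX.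
have /vlineP[k q_eq] : q - n *: p \in <[p - m *: q]>%VS.
  by rewrite eqX memv_line.
have eq_pq : (n + k) *: p = (1 + k * m) *: q.
  apply/esym/eqP; rewrite -subr_eq0; apply/eqP.
  transitivity (q - n *: p - k *: (p - m *: q)); last by rewrite q_eq subrr.
  by apply/rowP => i; rewrite !mxE; ring.
have [/eqP + /eqP] := distinct_points_indep Pp Qq neqPQ eq_pq.
by rewrite !addr_eq0 => /eqP -> /eqP ->; rewrite mulrN mulrC.
Qed.

(** One half of the theorem of Menelaus. The combination with coefficients
    [1, l, l * m] of the three side vectors telescopes to [(1 - l * m * n) *: p].
    Were this coefficient nonzero, a line through the three side points would
    contain [p], hence [q] and [s], and the triangle would be degenerate. *)
Lemma collinear_ratio P Q S X Y Z p q s l m n :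
    val P = <[p]>%VS -> val Q = <[q]>%VS -> val S = <[s]>%VS ->
    val X = <[p - l *: q]>%VS -> val Y = <[q - m *: s]>%VS ->
    val Z = <[s - n *: p]>%VS -> l != 0 -> m != 0 ->
    ~ collinear P Q S -> collinear X Y Z ->
  l * m * n = 1.
Proof.
move=> Pp Qq Ss Xx Yy Zz l0 m0 nPQS [L []].
rewrite /incident Xx Yy Zz -!memvE => xL yL zL.
apply/eqP; apply: contra_notT nPQS => lmn1; exists L.
have d0 : 1 - l * m * n != 0 by rewrite subr_eq0 eq_sym.
have pL : p \in val L.
  rewrite -[p](scalerK d0) memvZ //.
  have -> : (1 - l * m * n) *: p =
      p - l *: q + l *: (q - m *: s) + (l * m) *: (s - n *: p).
    by apply/rowP => i; rewrite !mxE; ring.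
  by apply: memvD; [apply: memvD => //|]; apply: memvZ.
have qL : q \in val L.
  rewrite -[q](scalerK l0) memvZ //.
  have -> : l *: q = p - (p - l *: q) by rewrite subKr.
  by rewrite memvB.
have sL : s \in val L.
  rewrite -[s](scalerK m0) memvZ //.
  have -> : m *: s = q - (q - m *: s) by rewrite subKr.
  by rewrite memvB.
by rewrite /incident Pp Qq Ss -!memvE.
Qed.

(** The other half of the theorem of Menelaus. When the product is 1, the same
    telescoping combination vanishes, and it expresses the third side vector
    through the first two. Since [p], [q] and [s] may be dependent, this covers a
    degenerate triangle, and [X <> Y] is what makes the first two span a line. *)
Lemma ratio_collinear X Y Z p q s l m n :
    val X = <[p - l *: q]>%VS -> val Y = <[q - m *: s]>%VS ->
    val Z = <[s - n *: p]>%VS -> X <> Y -> l * m * n = 1 ->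
  collinear X Y Z.
Proof.
move=> Xx Yy Zz neqXY lmn1.
have dXY : \dim (val X + val Y) == 2 by rewrite dim_join.
exists (exist _ (val X + val Y)%VS dXY).
rewrite /incident /= addvSl addvSr; split=> //.
rewrite Zz -memvE.
have -> : s - n *: p = - n *: (p - l *: q) + (- n * l) *: (q - m *: s).
  rewrite -[s in LHS]scale1r -lmn1.
  by apply/rowP => i; rewrite !mxE; ring.
by rewrite memv_add // ?Xx ?Yy memvZ ?memv_line.
Qed.
End Points.

(** * Products over the darts of a triangulation *)

Section OrbitProducts.
Variables (R : comNzRingType) (D : finType) (s : {perm D}) (F : D -> R).
Local Open Scope ring_scope.

Lemma prod_porbits :
  \prod_x F x = \prod_(c in porbits s) \prod_(x in c) F x.
Proof.
rewrite (partition_big (porbit s) (mem (porbits s))) /=; last first.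
  by move=> x _; apply: imset_f.
apply: eq_bigr => _ /imsetP[y _ ->]; apply: eq_bigl => x.
by rewrite eq_porbit_mem.
Qed.

Lemma prod_porbit x :
  \prod_(y in porbit s x) F y = \prod_(y <- traject s x #|porbit s x|) F y.
Proof.
rewrite [RHS]big_uniq ?uniq_traject_porbit //.
by apply: eq_bigl => y; rewrite porbit_traject.
Qed.
End OrbitProducts.

Section Darts.
Variable T : triangulation.
Implicit Types x y : dart T.

Lemma porbit_rev x : porbit (rev T) x = [set x; rev T x].
Proof.
apply/setP => y; rewrite !inE; apply/idP/idP => [/porbitP[i ->]|].
  elim: i => [|i]; first by rewrite expg0 perm1 eqxx.
  rewrite expgSr permM => /orP[] /eqP ->; rewrite ?revK eqxx ?orbT //.
by case/orP=> /eqP ->; rewrite ?porbit_id // (mem_porbit _ 1).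
Qed.

Lemma next3 x : next T (next T (next T x)) = x.
Proof. by have := iter_porbit (next T) x; rewrite card_next. Qed.

(** Were two consecutive sides of a triangle the same edge, either the first side
    or the third one would be a loop. *)
Lemma edge_of_next : loopless T -> forall x, edge_of x <> edge_of (next T x).
Proof.
move=> noloop x /to_orbitP; rewrite porbit_rev !inE => /orP[] /eqP x_eq.
  by apply: (noloop x); rewrite -source_next -x_eq.
apply: (noloop (next T (next T x))).
by rewrite -source_next next3 source_next /target -x_eq.
Qed.

Variables (R : comNzRingType) (m : dart T -> R).
Local Open Scope ring_scope.

Lemma prod_triangle x :
  \prod_(y in porbit (next T) x) m y =
  m x * m (next T x) * m (next T (next T x)).
Proof. by rewrite prod_porbit card_next /= !big_cons big_nil mulr1 mulrA. Qed.

(** The two directions of each edge contribute inverse factors. *)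
Lemma prod_darts1 : (forall x, m x * m (rev T x) = 1) -> \prod_x m x = 1.
Proof.
move=> m_rev; rewrite (prod_porbits (rev T)) big1 // => _ /imsetP[x _ ->].
by rewrite porbit_rev big_setU1 /= ?big_set1 ?m_rev // inE eq_sym rev_neq.
Qed.

(** The darts can be grouped by edges or by triangles. The first grouping shows
    that the total product is 1, and by the second one it is the product of the
    factors of the triangles, all of which but one are known to be 1. *)
Lemma prod_remaining_triangle (t0 : triangle T) :
    (forall x, m x * m (rev T x) = 1) ->
    (forall x, triangle_of x <> t0 ->
       m x * m (next T x) * m (next T (next T x)) = 1) ->
  forall x, triangle_of x = t0 ->
    m x * m (next T x) * m (next T (next T x)) = 1.
Proof.
move=> m_rev m_tri x xt0; rewrite -prod_triangle -[RHS](prod_darts1 m_rev).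
rewrite (prod_porbits (next T)) (bigD1 (porbit (next T) x)) ?imset_f //=.
rewrite [X in _ * X]big1 ?mulr1 // => _ /andP[/imsetP[y _ ->] neq_yx].
rewrite prod_triangle m_tri // -xt0 => /(congr1 val) /= eq_yx.
by rewrite eq_yx eqxx in neq_yx.
Qed.
End Darts.

(** * The incidence theorem *)

Theorem corollary8p3 (R : realType) (K : fieldType)
    (K_real_or_complex : K = (R : fieldType) \/ K = (R[i] : fieldType))
    (T : triangulation) (T_loopless : loopless T)
    (Pv : vertex T -> point K) (Pe : edge T -> point K)
    (Pe_on_line : forall x : dart T,
       on_line_through (Pv (source x)) (Pv (target x)) (Pe (edge_of x)))
    (Pv_distinct : injective Pv)
    (Pe_distinct : injective Pe)
    (Pv_Pe_distinct : forall (v : vertex T) (e : edge T), Pv v <> Pe e)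
    (t0 : triangle T)
    (nondegenerate : forall t : triangle T, t <> t0 ->
       vertices_not_collinear Pv t)
    (collinear_except_t0 : forall t : triangle T, t <> t0 ->
       sides_collinear Pe t) :
  sides_collinear Pe t0.
Proof.
pose w x := vpick (val (Pv (source x))).
have Pw x : val (Pv (source x)) = <[w x]>%VS by apply: point_pick.
have m_ex x : exists m, (m != 0)%R /\
    val (Pe (edge_of x)) = <[w x - m *: w (next T x)]>%VS.
  have [] := on_line_ratio (Pw x) (Pw (next T x)) _ (@Pv_Pe_distinct _ _)
    (@Pv_Pe_distinct _ (edge_of x)).
    by rewrite source_next; apply: Pe_on_line.
  by move=> m m0 Xm; exists m.
have [m mP] := fin_all_exists m_ex.
have m0 x : (m x != 0)%R by case: (mP x).
have Pm x : val (Pe (edge_of x)) = <[w x - m x *: w (next T x)]>%VS.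
  by case: (mP x).
(* After three steps [next] returns to [x], which closes up the triangle. *)
have Pm3 x : val (Pe (edge_of (next T (next T x)))) =
    <[w (next T (next T x)) - m (next T (next T x)) *: w x]>%VS.
  by rewrite Pm next3.
have m_rev x : (m x * m (rev T x) = 1)%R.
  apply: (ratio_rev (Pw x) (Pw (next T x))).
    by rewrite source_next => /Pv_distinct; apply: T_loopless.
  rewrite -Pm -edge_of_rev Pm.
  by rewrite /w !source_next /target revK.
have m_tri x : triangle_of x <> t0 ->
    (m x * m (next T x) * m (next T (next T x)) = 1)%R.
  move=> xt0; apply: (collinear_ratio _ _ _ (Pm x) (Pm _) (Pm3 x)) => //.
  - exact: nondegenerate xt0 x erefl.
  - exact: collinear_except_t0 xt0 x erefl.
move=> x xt0; apply: (ratio_collinear (Pm x) (Pm _) (Pm3 x)).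
- by move=> /Pe_distinct; apply: edge_of_next.
- exact: prod_remaining_triangle m_rev m_tri x xt0.
Qed.
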